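(* Let $G\in\mathcal{CT}^{\geqslant 2}_{ev}$. Then the $\mathcal E$-spectrum of $G$ is not symmetric.
   Context: Graphs are finite, simple and undirected. A cut-vertex of a connected graph $G$ is a vertex whose removal disconnects $G$; a block of $G$ is a maximal connected subgraph $B$ having no cut-vertices of its own (no cut-vertex of $B$). A clique tree is a connected graph whose blocks are all complete graphs. $\mathcal{CT}$ is the class of clique trees $G$ such that each block of $G$ contains at most two cut-vertices of $G$. $\mathcal{CT}^{\geqslant 2}$ is the set of graphs in $\mathcal{CT}$ with diameter at least $2$, and $\mathcal{CT}^{\geqslant 2}_{ev}$ is the set of graphs in $\mathcal{CT}^{\geqslant 2}$ with even diameter. For a connected graph $G$, $d_G(u,v)$ is the distance and $e_G(u)=\max\{d_G(u,v)\mid v\in V_G\}$ the eccentricity of $u$. The eccentricity matrix $\mathcal E(G)=(\epsilon_{uv})$, indexed by $V_G\times V_G$, has $\epsilon_{uv}=d_G(u,v)$ if $d_G(u,v)=\min\{e_G(u),e_G(v)\}$ and $\epsilon_{uv}=0$ otherwise. The $\mathcal E$-spectrum of $G$ is the multiset of eigenvalues of $\mathcal E(G)$; it is called symmetric if it is symmetric with respect to $0$, i.e. for every real $\lambda$ the multiplicities of $\lambda$ and $-\lambda$ as eigenvalues of $\mathcal E(G)$ are equal. *)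

(* Defs.v *)
From mathcomp Require Import all_boot all_order all_algebra.
From mathcomp Require Import reals.
Set Implicit Arguments.
Unset Strict Implicit.
Unset Printing Implicit Defensive.
Import GRing.Theory.

Record sgraph := SGraph {
  vert :> finType;
  adj : rel vert;
  adj_sym : symmetric adj;
  adj_irr : irreflexive adj }.

(* Subgraphs are arbitrary (a vertex set and an edge relation on it), not
   necessarily induced. *)
Record subgraph (G : sgraph) := Subgraph {
  sverts : {set G};
  sedge : rel G;
  sedge_sym : symmetric sedge;
  sedge_sub : forall x y, sedge x y ->
    [&& adj x y, x \in sverts & y \in sverts] }.

Section Subgraphs.
Variable G : sgraph.
Implicit Types (H B : subgraph G) (x y : G).

Fact whole_sub x y : adj x y -> [&& adj x y, x \in [set: G] & y \in [set: G]].
Proof. by move=> xy; rewrite xy !inE. Qed.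

Definition whole : subgraph G := Subgraph (@adj_sym G) whole_sub.

Definition del_edge H x : rel G :=
  [rel y z | [&& sedge H y z, y != x & z != x]].

Fact del_edge_sym H x : symmetric (del_edge H x).
Proof. by move=> y z; rewrite /del_edge /= (sedge_sym H) [(y != x) && _]andbC. Qed.

Fact del_edge_sub H x y z : del_edge H x y z ->
  [&& adj y z, y \in sverts H :\ x & z \in sverts H :\ x].
Proof.
by case/and3P=> /sedge_sub/and3P[yz yH zH] yx zx; rewrite !inE yz yH zH yx zx.
Qed.

Definition del_vertex H x : subgraph G :=
  Subgraph (del_edge_sym H x) (@del_edge_sub H x).

Definition disconnected H : bool :=
  [exists x in sverts H, exists y in sverts H, ~~ connect (sedge H) x y].

(* Connected graphs are nonempty.  The empty graph is neither [connected] nor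
   [disconnected], so the vertex of a one-vertex graph is not a cut-vertex. *)
Definition connected H : bool := (sverts H != set0) && ~~ disconnected H.

Definition cut_vertex H x : bool :=
  (x \in sverts H) && disconnected (del_vertex H x).

Definition subgraph_le H1 H2 : Prop :=
  sverts H1 \subset sverts H2 /\ subrel (sedge H1) (sedge H2).

Definition connected_without_cut_vertex B : Prop :=
  connected B /\ forall x, ~~ cut_vertex B x.

Definition block B : Prop :=
  connected_without_cut_vertex B /\
  forall B', connected_without_cut_vertex B' ->
    subgraph_le B B' -> subgraph_le B' B.

Definition is_complete B : Prop :=
  {in sverts B &, forall x y, x != y -> sedge B x y}.

End Subgraphs.

Definition clique_tree (G : sgraph) : Prop :=
  connected (whole G) /\ forall B : subgraph G, block B -> is_complete B.

Definition CT (G : sgraph) : Prop :=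
  clique_tree G /\
  forall B : subgraph G, block B ->
    #|[set x in sverts B | cut_vertex (whole G) x]| <= 2.

Section Distance.
Variable G : sgraph.

Definition walk_of_length (n : nat) (u v : G) : bool :=
  [exists p : n.-tuple G, path (@adj G) u p && (last u p == v)].

(* The least n such that there is a walk of length n from u to v (at most
   #|G| - 1), with junk value #|G| if v is not reachable from u. *)
Definition dist (u v : G) : nat :=
  find (fun n => walk_of_length n u v) (iota 0 #|G|).

Definition ecc (u : G) : nat := \max_(v : G) dist u v.

Definition diam : nat := \max_(u : G) ecc u.

Local Open Scope ring_scope.

Definition ecc_entry (u v : G) : nat :=
  if dist u v == minn (ecc u) (ecc v) then dist u v else 0%N.

Definition ecc_matrix (R : realType) : 'M[R]_#|G| :=
  \matrix_(i, j) (ecc_entry (enum_val i) (enum_val j))%:R.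

(* The multiplicity of an eigenvalue is its multiplicity as a root of the
   characteristic polynomial. *)
Definition E_spectrum_symmetric (R : realType) : Prop :=
  forall lambda : R,
    mup lambda (char_poly (ecc_matrix R)) =
    mup (- lambda) (char_poly (ecc_matrix R)).

End Distance.

Definition CT_ge2 (G : sgraph) : Prop := CT G /\ 2 <= diam G.

Definition CT_ge2_ev (G : sgraph) : Prop := CT_ge2 G /\ ~~ odd (diam G).

(* Main.v *)
(* The eccentricity matrix is nonnegative and symmetric.  If its spectrum were
   symmetric, the sum of the cubes of its eigenvalues, i.e. the trace of its
   cube, would vanish; so it suffices to exhibit a triangle of nonzero entries.
   Let u, v be at distance diam G = 2r and let c be the midpoint of a geodesic
   from u to v.  In a clique tree every cycle lies in a block and hence spans a
   clique, so c separates u from v.  Any vertex w is then separated by c from u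
   or from v, whence d(c, w) + r <= 2r; thus c has eccentricity r, and the
   (u, v), (v, c) and (c, u) entries are 2r, r and r. *)
Require Import Defs.
From mathcomp Require Import all_boot all_order all_algebra.
From mathcomp Require Import reals boolp complex.
Set Implicit Arguments.
Unset Strict Implicit.
Unset Printing Implicit Defensive.
Import Order.TTheory GRing.Theory Num.Theory.

(** * Blocks, cycles and cliques *)

Section Blocks.
Variable G : sgraph.
Implicit Types (B H : subgraph G) (S : {set G}) (s : seq G).

Lemma subgraph_le_trans B1 B2 B3 :
  subgraph_le B1 B2 -> subgraph_le B2 B3 -> subgraph_le B1 B3.
Proof.
move=> [v12 e12] [v23 e23]; split; first exact: subset_trans v23.
by move=> x y /e12/e23.
Qed.

(** Induction on the number [m B] of missing vertices and missing ordered pairs: a subgraph that is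
    not yet a block has a strictly larger competitor, for which this number is smaller. *)
Lemma block_extension B :
  connected_without_cut_vertex B ->
  exists B', block B' /\ subgraph_le B B'.
Proof.
pose edges H := [set e : G * G | sedge H e.1 e.2].
pose m H := (#|~: sverts H| + #|~: edges H|)%N.
have [k] := ubnP (m B); elim: k B => // k IHk B /ltnSE leBk Bc.
have [Bblock|] := pselect (block B); first by exists B; split=> //; split.
move=> nB; have [B' [B'c [leBB' nleB'B]]] : exists B',
    connected_without_cut_vertex B' /\ subgraph_le B B' /\ ~ subgraph_le B' B.
  apply: contrapT => nex; apply: nB; split=> // B' B'c leBB'.
  apply: contrapT => nle; apply: nex; exists B'.
  exact: (conj B'c (conj leBB' nle)).
have [|C [Cb leB'C]] := IHk B' _ B'c; last first.
  by exists C; split=> //; apply: subgraph_le_trans leB'C.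
apply: leq_trans leBk; have [leV leE] := leBB'.
have leE' : edges B \subset edges B'.
  by apply/subsetP=> -[x y]; rewrite !inE; apply: leE.
(* Strict growth gains a vertex or, on the same vertex set, an edge. *)
have [leV'|nleV'] := boolP (sverts B' \subset sverts B); last first.
  rewrite -addSn leq_add // ?subset_leq_card ?setCS // proper_card //.
  by rewrite properE !setCS leV nleV'.
rewrite -addnS leq_add // ?subset_leq_card ?setCS // proper_card //.
rewrite properE !setCS leE' /=; apply/negP => /subsetP leE''.
by apply: nleB'B; split=> // x y xy; have := leE'' (x, y); rewrite !inE; apply.
Qed.

Definition induced_edge S : rel G :=
  [rel x y | [&& adj x y, x \in S & y \in S]].

Fact induced_edge_sym S : symmetric (induced_edge S).
Proof.
by move=> x y; rewrite /induced_edge /= adj_sym [(x \in S) && _]andbC.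
Qed.

Definition induced S : subgraph G :=
  Subgraph (induced_edge_sym S) (fun x y (xy : induced_edge S x y) => xy).

Lemma path_not_disconnected H x s :
  sverts H \subset x :: s -> path (sedge H) x s -> ~~ disconnected H.
Proof.
move=> /subsetP Hs xs; apply/negP => /existsP[y /andP[/Hs ys]].
case/existsP=> z /andP[/Hs zs] /negP[]; have cx := path_connect xs.
apply: connect_trans (cx z zs).
by rewrite (sym_connect_sym (sedge_sym H)); apply: cx.
Qed.

(** Deleting a vertex from a cycle leaves a path through all the other vertices. *)
Lemma cycle_without_cut_vertex s : s != [::] -> uniq s -> cycle (@adj G) s ->
  connected_without_cut_vertex (induced [set x in s]).
Proof.
case: s => // x s _ us cs; split.
  apply/andP; split; first by apply/set0Pn; exists x; rewrite !inE eqxx.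
  apply: (@path_not_disconnected _ x s).
    by apply/subsetP => y; rewrite !inE.
  move: cs; rewrite /= rcons_path => /andP[ps _].
  apply: (@sub_in_path _ [in x :: s] (@adj G)) ps; last by apply/allP.
  by move=> y z; rewrite !inE => ys zs yz; rewrite /induced_edge /= yz !inE
    ys zs.
(* Rotate the cycle so that it starts at the deleted vertex [y]; the rest [t] is then the required
   path. *)
move=> y; apply/negP => /andP[]; rewrite inE => /rot_to[i t st].
apply/negP; have {cs}: cycle (@adj G) (y :: t) by rewrite -st rot_cycle.
have {us}: uniq (y :: t) by rewrite -st rot_uniq.
have memt : x :: s =i y :: t by move=> z; rewrite -st mem_rot.
case: t memt {st} => [|z t] memt; first move=> _ _.
  apply/negP => /existsP[w /andP[]]; rewrite !inE -!in_cons memt inE.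
  by case: eqP.
move=> /= /andP[yzt _]; rewrite rcons_path => /andP[_ /andP[zt _]].
apply: (@path_not_disconnected _ z t).
  apply/subsetP => w; rewrite !inE -!in_cons memt inE.
  by rewrite 2!in_cons; case: eqP.
apply: (@sub_in_path _ [in z :: t] (@adj G)) zt; last by apply/allP.
move=> v w; rewrite -!topredE /= => vt wt vw.
rewrite /= /del_edge /= /induced_edge /= vw ![_ \in [set _ in _]]inE !memt.
rewrite ![_ \in y :: _]in_cons vt wt !orbT /=.
by apply/andP; split; apply: contraNneq yzt => <-.
Qed.

Lemma path_del_vertex c x s : path (@adj G) x s -> c \notin x :: s ->
  path (sedge (del_vertex (whole G) c)) x s.
Proof.
move=> xs cs; apply: (@sub_in_path _ (predC1 c) (@adj G)) xs.
  by move=> y z yc zc yz; rewrite /= /del_edge /= yz /=; apply/andP.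
by apply/allP => y ys /=; apply: contraNneq cs => <-.
Qed.

Hypothesis Gct : clique_tree G.

(** The cycle extends to a block, which is complete. *)
Lemma clique_tree_cycle s : uniq s -> cycle (@adj G) s ->
  {in s &, forall x y, x != y -> adj x y}.
Proof.
move=> us cs x y xs ys xy.
have [|B [Bb [sVB _]]] := block_extension (cycle_without_cut_vertex _ us cs).
  by case: s xs {us cs ys}.
have sB z : z \in s -> z \in sverts B.
  by move=> zs; apply: (subsetP sVB); rewrite inE.
by have /sedge_sub/andP[] := Gct.2 _ Bb _ _ (sB x xs) (sB y ys) xy.
Qed.

(** A simple path from [a] to [b] avoiding [c] closes up through [c] to a cycle, whose vertices are
    pairwise adjacent. *)
Lemma clique_tree_neighbors c a b : adj c a -> adj c b -> a != b ->
  connect (sedge (del_vertex (whole G) c)) a b -> adj a b.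
Proof.
move=> ca cb ab /connectP[p0 p0P lp0].
case/shortenP: p0P lp0 => p ap up _ lp.
have cp : c \notin a :: p.
  rewrite inE negb_or; apply/andP; split.
    by apply: contraTneq ca => <-; rewrite adj_irr.
  elim: p a ap {ca ab up lp} => //= x p IHp a /andP[/and3P[_ _ xc]] /IHp.
  by rewrite inE negb_or eq_sym xc.
have cyc : cycle (@adj G) [:: c, a & p].
  rewrite /= ca rcons_path -lp adj_sym cb andbT.
  by apply: sub_path ap => x y /andP[].
apply: (clique_tree_cycle _ cyc) => //; first by rewrite cons_uniq cp.
  by rewrite !inE eqxx orbT.
by rewrite lp inE mem_last orbT.
Qed.

End Blocks.

(** * Distances and geodesics *)

Section Distance.
Variable G : sgraph.
Implicit Types (u v w c : G) (p : seq G).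

Lemma dist_le_path u p : path (@adj G) u p -> dist u (last u p) <= size p.
Proof.
(* A path with at least [#|G|] steps is no shorter than the junk value, which bounds every
   [dist]. *)
move=> up; rewrite /dist; have [pG|Gp] := ltnP (size p) #|G|; last first.
  by apply: leq_trans Gp; rewrite -[leqRHS](size_iota 0) find_size.
rewrite leqNgt; apply/negP => /(before_find 0%N); rewrite nth_iota // add0n.
by move/existsP; apply; exists (in_tuple p); rewrite /= up eqxx.
Qed.

Hypothesis Gconn : connected (whole G).

Lemma geodesic u v : exists p,
  [/\ path (@adj G) u p, last u p = v, uniq (u :: p) & size p = dist u v].
Proof.
have uv : connect (@adj G) u v.
  case/andP: Gconn => _; apply: contraNT => nuv.
  by apply/existsP; exists u; rewrite inE; apply/existsP; exists v; rewrite inE.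
(* A walk without repeated vertices has fewer than [#|G|] steps, so the search in [dist]
   succeeds. *)
have hasw : has (fun n => walk_of_length n u v) (iota 0 #|G|).
  case/connectP: uv => p up ->; case/shortenP: up => q uq Uq _.
  apply/hasP; exists (size q).
    rewrite mem_iota add0n /= -[(size q).+1]/(size (u :: q)).
    by rewrite -(card_uniqP Uq) max_card.
  by apply/existsP; exists (in_tuple q); rewrite /= uq eqxx.
have := nth_find 0 hasw; rewrite nth_iota; last first.
  by rewrite -[X in _ < X](size_iota 0) -has_find.
rewrite add0n -/(dist u v) => /existsP[p /andP[up /eqP lp]].
(* Removing repetitions from a shortest walk cannot lower its length, so [q] is still shortest. *)
move: (size_tuple p) lp; case/shortenP: up => q uq Uq qp sp lq.
exists q; split=> //; apply/eqP; rewrite eqn_leq -{1}sp -{2}lq dist_le_path //.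
by rewrite andbT uniq_leq_size //; case/andP: Uq.
Qed.

Lemma dist_triangle c u v : dist u v <= dist u c + dist c v.
Proof.
have [p [up lp _ <-]] := geodesic u c; have [q [cq lq _ <-]] := geodesic c v.
have := @dist_le_path u (p ++ q).
by rewrite cat_path last_cat lp lq size_cat up; apply.
Qed.

Lemma dist_sym u v : dist u v = dist v u.
Proof.
suff le (x y : G) : dist x y <= dist y x by apply/eqP; rewrite eqn_leq !le.
have [p [yp lp _ <-]] := geodesic y x.
have := @dist_le_path x (rev (belast y p)).
rewrite size_rev size_belast -lp.
rewrite rev_path (eq_path (e' := @adj G)); last by move=> ? ?; rewrite adj_sym.
move=> /(_ yp); case: p {yp lp} => [|z p] //=.
by rewrite rev_cons last_rcons.
Qed.

(** Every geodesic from [u] to [v] must pass through [c], which cuts it into two paths. *)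
Lemma dist_cut c u v : ~~ connect (sedge (del_vertex (whole G) c)) u v ->
  dist u c + dist c v <= dist u v.
Proof.
move=> nuv; have [p [up lp _ <-]] := geodesic u v.
have cp : c \in u :: p.
  apply: contraNT nuv => cp; apply/connectP; exists p => //.
  exact: path_del_vertex.
case/splitPl: cp up lp => p1 p2 lp1; rewrite cat_path last_cat lp1 size_cat.
case/andP=> up1 cp2 <-; rewrite leq_add ?dist_le_path // -lp1 dist_le_path //.
Qed.

Lemma ecc_matrix_sym (R : realType) : ((ecc_matrix G R)^T = ecc_matrix G R)%R.
Proof.
by apply/matrixP => i j; rewrite !mxE /ecc_entry dist_sym minnC.
Qed.

End Distance.

(* The two neighbours of the midpoint on the geodesic are not adjacent, so no
   cycle passes through all three. *)
Lemma geodesic_midpoint_separates (G : sgraph) (u v : G) r :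
    clique_tree G -> 0 < r -> dist u v = r.*2 ->
  exists c, [/\ dist u c = r, dist c v = r &
    ~~ connect (sedge (del_vertex (whole G) c)) u v].
Proof.
move=> Gct r_gt0 duv; have Gc := Gct.1.
have [p [up lp Up sp]] := geodesic Gc u v.
have := cat_take_drop r p; have s1 : size (take r p) = r.
  by rewrite size_takel // sp duv -addnn leq_addr.
have s2 : size (drop r p) = r by rewrite size_drop sp duv -addnn addnK.
(* Since [p] omits its start [u], its [r]-th entry [c] is the midpoint. Its neighbours on the
   geodesic are [a], the last vertex of [u :: p1], and [b]. *)
move: s1 s2; case/lastP: (take r p) => [|p1 c];
  first by move=> r0; rewrite -r0 in r_gt0.
case: (drop r p) => [|b p2]; first by move=> _ r0; rewrite -r0 in r_gt0.
rewrite size_rcons cat_rcons => s1 s2 ep.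
move: up lp; rewrite -{1 2}ep last_cat cat_path /= => /and4P[up1 ac cb bp2] lp.
have : uniq ((u :: p1) ++ c :: b :: p2) by rewrite cat_cons ep.
rewrite uniq_catC cat_cons cons_uniq.
rewrite mem_cat negb_or cat_uniq => /and3P[/andP[cbp2 cup1] _ /andP[dis _]].
set a := last u p1 in ac *; have aup1 : a \in u :: p1 by apply: mem_last.
have ab : a != b.
  by apply: contraNneq (hasPn dis a aup1) => ->; apply: mem_head.
have uc : dist u c <= r.
  rewrite -s1 -(size_rcons p1 c) -[X in dist _ X](last_rcons u p1).
  by apply: dist_le_path; rewrite rcons_path up1.
have cv : dist c v <= r.
  by rewrite -s2 -lp; apply: (@dist_le_path _ c (b :: p2)); rewrite /= cb.
(* Both halves are at most [r] and sum to at least [2r], so each equals [r]. *)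
have := dist_triangle Gc c u v; rewrite duv -addnn => tri.
exists c; split; last 1 first.
- apply/negP => uv.
  have ua := path_connect (path_del_vertex up1 cup1) aup1.
  have bv : connect (sedge (del_vertex (whole G) c)) b v.
    apply: (path_connect (path_del_vertex bp2 cbp2)).
    by rewrite -lp; apply: mem_last.
  (* If [u] and [v] were connected off [c], so would be [a] and [b], through the two halves of the
     geodesic. *)
  have : adj a b.
    apply: (clique_tree_neighbors Gct _ cb ab); first by rewrite adj_sym.
    have sC := sym_connect_sym (sedge_sym (del_vertex (whole G) c)).
    rewrite sC in ua; rewrite sC in bv.
    exact: connect_trans ua (connect_trans uv bv).
  (* Skipping [c] along the edge from [a] to [b] gives a path of length [2r - 1]. *)
  move=> adjab; have := @dist_le_path _ u (p1 ++ b :: p2).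
  rewrite cat_path last_cat /= up1 bp2 adjab lp size_cat s2 duv -addnn -s1.
  by rewrite leq_add2r ltnn => /(_ isT).
- by apply/eqP; rewrite eqn_leq uc -(leq_add2r r) (leq_trans tri) ?leq_add2l.
- by apply/eqP; rewrite eqn_leq cv -(leq_add2l r) (leq_trans tri) ?leq_add2r.
Qed.

(** * Spectrum and trace of the cube of a symmetric matrix *)

Local Open Scope ring_scope.

Lemma char_poly_conj (F : fieldType) n (P D : 'M[F]_n) : P \in unitmx ->
  char_poly (invmx P *m D *m P) = char_poly D.
Proof.
move=> Pu; rewrite /char_poly /char_poly_mx !map_mxM.
have PVP : map_mx polyC (invmx P) *m map_mx polyC P = 1%:M.
  by rewrite -map_mxM mulVmx // map_mx1.
have -> : 'X%:M - map_mx polyC (invmx P) *m map_mx polyC D *m map_mx polyC P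
   = map_mx polyC (invmx P) *m ('X%:M - map_mx polyC D) *m map_mx polyC P.
  by rewrite mulmxBr mulmxBl scalar_mxC -[X in _ = X - _]mulmxA PVP mulmx1.
by rewrite !det_mulmx mulrAC -det_mulmx PVP det1 mul1r.
Qed.

(** Over [R[i]] the matrix is Hermitian, hence diagonalizable with real eigenvalues. Both identities
    are checked there and pulled back along the injective embedding of [R]. *)
Lemma symmetric_real_spectrum (R : rcfType) n (A : 'M[R]_n) : A^T = A ->
  exists s : seq R, char_poly A = \prod_(x <- s) ('X - x%:P) /\
    \tr (A *m A *m A) = \sum_(x <- s) x ^+ 3.
Proof.
move=> AT; pose f : {rmorphism R -> R[i]} := real_complex R.
have fI : injective f by exact: complexI.
pose B := map_mx f A.
have Bh : B \is hermsymmx.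
  apply: realsym_hermsym; last first.
    apply/mxOverP => i j; rewrite mxE; apply/complex_realP; by exists (A i j).
  by apply/is_hermitianmxP; rewrite expr0 scale1r map_mx_id // map_trmx AT.
have /mxOverP dreal := hermitian_spectral_diag_real Bh.
have /orthomx_spectralP eB := hermitian_normalmx Bh.
have Pu := spectral_unit B.
move: eB dreal Pu; set P := spectralmx B; set d := spectral_diag B.
move=> eB dreal Pu.
have dE i : d 0 i = f (complex.Re (d 0 i)) by rewrite [RHS]RRe_real.
exists [seq complex.Re (d 0 i) | i <- index_enum 'I_n]; split.
  apply: (map_poly_inj f); rewrite map_char_poly -/B eB char_poly_conj //.
  rewrite char_poly_trig; last exact/diag_mx_is_trig.
  rewrite rmorph_prod /= big_map; apply: eq_bigr => i _.
  by rewrite rmorphB /= map_polyX map_polyC /= -[in RHS]dE !mxE eqxx.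
apply: fI; rewrite -trace_map_mx !map_mxM -/B.
have -> : B *m B *m B = invmx P *m (diag_mx d *m diag_mx d *m diag_mx d) *m P.
  by rewrite [in LHS]eB !mulmxA !(mulmxKV, mulmxK).
rewrite mxtrace_mulC mulKVmx // rmorph_sum /= big_map.
rewrite /mxtrace; apply: eq_bigr => i _.
rewrite !mulmx_diag !mxE eqxx mulr1n rmorphXn /= -[in RHS]dE.
by rewrite !exprS expr0 mulr1 mulrA.
Qed.

Lemma symmetric_spectrum_trace_cube (R : rcfType) n (A : 'M[R]_n) :
    A^T = A ->
    (forall x, mup x (char_poly A) = mup (- x) (char_poly A)) ->
  \tr (A *m A *m A) = 0.
Proof.
move=> /symmetric_real_spectrum[s [-> ->]] msym.
(* The multiplicity of a root is its number of occurrences in [s]. *)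
have eqs : perm_eq s [seq - x | x <- s].
  apply/allP => x _ /=; apply/eqP; rewrite count_map -[LHS]mu_prod_XsubC msym.
  by rewrite mu_prod_XsubC; apply: eq_count => y /=; rewrite -eqr_oppLR.
have : \sum_(x <- s) x ^+ 3 = - \sum_(x <- s) x ^+ 3.
  rewrite [LHS](perm_big _ eqs) big_map -sumrN; apply: eq_bigr => x _.
  by rewrite exprNn -signr_odd mulN1r.
by move/eqP; rewrite -addr_eq0 -mulr2n mulrn_eq0 => /eqP.
Qed.

(** The trace expands into nonnegative products over closed walks of length 3, and the walk through
    [i], [j], [k] contributes a positive one. *)
Lemma trace_cube_gt0 (R : numDomainType) n (A : 'M[R]_n) i j k :
    (forall i j, 0 <= A i j) -> 0 < A i j -> 0 < A j k -> 0 < A k i ->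
  0 < \tr (A *m A *m A).
Proof.
move=> A0 ij jk ki; rewrite /mxtrace (bigD1 i) //= ltr_pwDl //; last first.
  apply: sumr_ge0 => l _; rewrite !mxE sumr_ge0 // => m _.
  by rewrite mxE mulr_ge0 // sumr_ge0 // => o _; rewrite mulr_ge0.
rewrite !mxE (bigD1 k) //= ltr_pwDl //; last first.
  apply: sumr_ge0 => m _.
  by rewrite mxE mulr_ge0 // sumr_ge0 // => o _; rewrite mulr_ge0.
rewrite mxE mulr_gt0 // (bigD1 j) //= ltr_pwDl ?mulr_gt0 //.
by apply: sumr_ge0 => o _; rewrite mulr_ge0.
Qed.

Theorem theorem4p4 (R : realType) (G : sgraph) (hG : CT_ge2_ev G) :
  ~ E_spectrum_symmetric G R.
Proof.
case: hG => -[[Gct _] diam2] evd Esym; have Gc := Gct.1.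
have Gn0 : (0 < #|G|)%N.
  by case/andP: Gc => /set0Pn[x _] _; apply/card_gt0P; exists x.
have [u eu] := bigop.eq_bigmax (@ecc G) Gn0.
have [v ev] := bigop.eq_bigmax (dist u) Gn0.
have duv : dist u v = diam G by rewrite /diam eu /ecc ev.
pose r := (diam G)./2; have dr : diam G = r.*2.
  by rewrite -[LHS]odd_double_half (negbTE evd).
have r_gt0 : (0 < r)%N by rewrite -double_gt0 -dr (leq_trans _ diam2).
have [c [duc dcv sep]] := geodesic_midpoint_separates Gct r_gt0 (etrans duv dr).
have dist_ecc (x y : G) : (dist x y <= ecc x)%N.
  exact: (@leq_bigmax G (dist x) y).
have ecc_diam (x : G) : (ecc x <= r.*2)%N.
  by rewrite -dr; apply: (@leq_bigmax G (@ecc G) x).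
have dist_diam (x y : G) : (dist x y <= r.*2)%N.
  exact: leq_trans (ecc_diam x).
have ecc_u : ecc u = r.*2 by apply/eqP; rewrite eqn_leq ecc_diam -dr -duv /=.
have ecc_v : ecc v = r.*2.
  by apply/eqP; rewrite eqn_leq ecc_diam -dr -duv dist_sym /=.
have ecc_c : ecc c = r.
  apply/eqP; rewrite eqn_leq -{2}dcv; apply/andP; split=> //.
  apply/bigmax_leqP => w _.
  (* The case [w = c] needs no separate treatment: [c] has no edges left after its deletion, so it
     is not connected to [u]. *)
  have [cw|nuw] := boolP (connect (sedge (del_vertex (whole G) c)) u w).
    have nwv : ~~ connect (sedge (del_vertex (whole G) c)) w v.
      by apply: contra sep; apply: connect_trans.
    rewrite -(leq_add2r r) addnn -{1}dcv (leq_trans _ (dist_diam w v)) //.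
    by rewrite [dist c w]dist_sym // dist_cut.
  rewrite -(leq_add2l r) addnn -{1}duc (leq_trans _ (dist_diam u w)) //.
  exact: dist_cut.
have uv0 : (0 < ecc_entry u v)%N.
  by rewrite /ecc_entry ecc_u ecc_v minnn duv dr eqxx double_gt0.
have rr : (r <= r.*2)%N by rewrite -addnn leq_addl.
have vc0 : (0 < ecc_entry v c)%N.
  by rewrite /ecc_entry ecc_c ecc_v dist_sym // dcv (minn_idPr rr) eqxx.
have cu0 : (0 < ecc_entry c u)%N.
  by rewrite /ecc_entry ecc_c ecc_u dist_sym // duc (minn_idPl rr) eqxx.
have := symmetric_spectrum_trace_cube (ecc_matrix_sym Gc R) Esym.
apply/eqP; rewrite gt_eqF //.
apply: (@trace_cube_gt0 _ _ _ (enum_rank u) (enum_rank v) (enum_rank c))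
  => [i j|||].
all: by rewrite mxE ?enum_rankK ?ler0n ?ltr0n.
Qed.
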